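(* Let $P_k$, $k=1,\dots,n$, be real polynomials of one variable of degree at most $d$, and assume that each $P_k$ is positive on an interval $I=(a,b)$, where $a,b\in\mathbb{R}\cup\{+\infty,-\infty\}$, $a<b$. Let $\alpha_1,\dots,\alpha_n$ be arbitrary real numbers. If the functions $P_1^{\alpha_1},\dots,P_n^{\alpha_n}$ are linearly independent (over $\mathbb{R}$) on $I$, and $c_1,\dots,c_n$ are real numbers that are not all zero, then the function $$f=\sum_{k=1}^{n} c_k P_k^{\alpha_k}$$ has no more than $4n^3d+n$ distinct roots on $I$. *)

(* Defs.v *)
From HB Require Import structures.
From mathcomp Require Import all_boot all_order all_algebra.
From mathcomp Require Import all_classical all_reals all_analysis.

Set Implicit Arguments.
Unset Strict Implicit.
Unset Printing Implicit Defensive.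

Import Order.TTheory GRing.Theory Num.Theory.

Local Open Scope classical_set_scope.
Local Open Scope ring_scope.

(* The library's [free] needs a finite-dimensional [vectType], hence this
   direct definition for functions restricted to a set. *)
Definition lin_indep_on (R : realType) (T : Type) (D : set T) (n : nat)
    (g : 'I_n -> T -> R) : Prop :=
  forall l : 'I_n -> R,
    (forall x, D x -> \sum_(k < n) l k * g k x = 0) -> forall k, l k = 0.

Definition open_itv (R : realType) (a b : \bar R) : set R :=
  [set x | (a < x%:E)%E /\ (x%:E < b)%E].

(* Main.v *)
(** Let [f 0, ..., f n.-1] be the power functions, [W k] the Wronskian of
    [f 0, ..., f k.-1] and [D k g] that of [f 0, ..., f k.-1, g].  From
      (D k g / W k.+1)' = W k * D k.+1 g / (W k.+1)^2
    and Rolle's theorem between the zeros of [W k.+1], the function [D k g] has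
    at most Z(D k.+1 g) + Z(W k) + 2 Z(W k.+1) + 1 zeros.  Iterating from
    [D 0 g = g] to [D m g = c m * W m.+1], where [m] is the last index with
    [c m != 0], bounds the zeros of [g = \sum_k c k * f k].  Since [W k] is a
    product of powers times a polynomial of degree at most [k * (k.-1 * d)],
    each [Z(W k)] is at most [n ^ 2 * d], unless [W k] vanishes identically.
    In that case, for the least such [k], the last function is a combination
    of the previous ones with coefficients that are locally constant off the
    zeros of a polynomial; being rational functions up to powers, these
    coefficients are constant, contradicting linear independence. *)

Require Import Defs.
From HB Require Import structures.
From mathcomp Require Import all_boot all_order all_algebra.
From mathcomp Require Import all_classical all_reals all_analysis.
From mathcomp Require Import finmap ring lra zify.

Set Implicit Arguments.
Unset Strict Implicit.
Unset Printing Implicit Defensive.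

Import Order.TTheory GRing.Theory Num.Theory.
Import numFieldNormedType.Exports.

Local Open Scope classical_set_scope.
Local Open Scope ring_scope.

(** * Formal Wronskians: column replacement and Cramer's rule *)

Definition upd (T : Type) (f : nat -> T) (j : nat) (g : T) (l : nat) : T :=
  if l == j then g else f l.

Lemma upd_map (T U : Type) (F : T -> U) f j g :
  (fun l => F (upd f j g l)) = upd (fun l => F (f l)) j (F g).
Proof. by apply/funext => l; rewrite /upd; case: eqP. Qed.

Section Wronskian.
Variable K : comPzRingType.
Implicit Types (h : nat -> nat -> K) (g r a : nat -> K).

(** The entry [h j i] stands for the [i]-th derivative of the [j]-th function at a point. Keeping
    these as formal entries lets the determinant identities be pure algebra. *)
Definition wronmx k h : 'M[K]_k := \matrix_(i, j) h j i.

Definition wron k h : K := \det (wronmx k h).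

Lemma wron_upd k h g (j : 'I_k) :
  wron k (upd h j g) = \sum_(i < k) g i * cofactor (wronmx k h) i j.
Proof.
rewrite /wron (expand_det_col _ j); apply: eq_bigr => i _.
rewrite mxE /upd eqxx; congr (_ * (_ * \det _)).
apply/matrixP => i' j'; rewrite !mxE ifF//.
by apply: negbTE; rewrite eq_sym; exact: neq_lift.
Qed.

Lemma wron_upd_col k h (j l : 'I_k) :
  wron k (upd h j (h l)) = if l == j then wron k h else 0.
Proof.
case: eqVneq => [->|lj].
  by congr wron; apply/funext => i; rewrite /upd; case: eqP => // ->.
rewrite /wron -det_tr; apply: (determinant_alternate lj) => i.
by rewrite !mxE /upd eqxx (negbTE (_ : (l != j :> nat))).
Qed.

(** This is the matrix times its adjugate, applied to the column [g]. *)
Lemma wron_cramer k h g i : (i < k)%N ->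
  \sum_(j < k) wron k (upd h j g) * h j i = wron k h * g i.
Proof.
move=> ik; pose i0 := Ordinal ik.
under eq_bigr do rewrite wron_upd big_distrl/=.
rewrite exchange_big/= (bigD1 i0)//= [X in _ + X]big1 ?addr0.
  have /matrixP/(_ i0 i0) := mul_mx_adj (wronmx k h).
  rewrite !mxE eqxx mulr1n /wron => <-; rewrite mulr_suml; apply: eq_bigr => j _.
  by rewrite !mxE/= mulrC [RHS]mulrC mulrCA mulrA.
move=> l li; have /matrixP/(_ i0 l) := mul_mx_adj (wronmx k h).
rewrite !mxE eq_sym (negbTE li) mulr0n => /(congr1 (fun x => g l * x)).
rewrite mulr0 mulr_sumr => E.
rewrite -[RHS]E; apply: eq_bigr => j _.
by rewrite !mxE/= -mulrA; congr (_ * _); rewrite mulrC.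
Qed.

(** By multilinearity in column [j], every term with [l != j] repeats a column and vanishes. *)
Lemma wron_upd_lin k h g a (j : 'I_k) :
  (forall i, (i < k)%N -> \sum_(l < k) a l * h l i = g i) ->
  wron k (upd h j g) = a j * wron k h.
Proof.
move=> hg; rewrite wron_upd.
under eq_bigr => i _ do rewrite -hg// mulr_suml.
rewrite exchange_big/= (bigD1 j)//= [X in _ + X]big1 ?addr0 => [|l lj].
  have := wron_upd_col h j j; rewrite eqxx => <-; rewrite wron_upd mulr_sumr.
  by apply: eq_bigr => i _; rewrite mulrA.
have := wron_upd_col h j l; rewrite (negbTE lj) wron_upd.
move=> /(congr1 (fun x => a l * x)); rewrite mulr0 mulr_sumr => E; rewrite -[RHS]E.
by apply: eq_bigr => i _; rewrite mulrA.
Qed.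

Lemma wron_upd_last k h r :
  (forall i, (i < k)%N -> r i = 0) -> wron k.+1 (upd h k r) = r k * wron k h.
Proof.
move=> r0; rewrite (wron_upd h r ord_max) big_ord_recr/= big1 ?add0r.
  rewrite /cofactor addnn -signr_odd odd_double expr0 mul1r.
  congr (_ * \det _); apply/matrixP => i j; rewrite !mxE.
  by congr (h _ _); rewrite lift_max.
by move=> i _; rewrite r0 ?mul0r.
Qed.

(** Subtracting from the last column the combination [a] of the others keeps the determinant and
    clears that column except for its corner entry, whose cofactor is [wron k h]. *)
Lemma wron_upd_residual k h g a :
  (forall i, (i < k)%N -> \sum_(j < k) a j * h j i = g i) ->
  wron k.+1 (upd h k g) = (g k - \sum_(j < k) a j * h j k) * wron k h.
Proof.
move=> hg; pose r i := g i - \sum_(j < k) a j * h j i.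
have r0 i : (i < k)%N -> r i = 0 by move=> ik; rewrite /r hg// subrr.
rewrite -[X in X * _]/(r k) -(wron_upd_last h r0).
rewrite !(wron_upd _ _ (ord_max : 'I_k.+1)) /r.
under [RHS]eq_bigr do rewrite mulrBl mulr_suml.
rewrite sumrB exchange_big/= [X in _ - X]big1 ?subr0// => j _.
have := wron_upd_col h (ord_max : 'I_k.+1) (widen_ord (leqnSn k) j).
rewrite ifF; last by apply/negbTE/eqP => /(congr1 val)/= /eqP; rewrite ltn_eqF.
rewrite wron_upd => /(congr1 (fun x => a j * x)); rewrite mulr0 => E.
by rewrite -[RHS]E mulr_sumr; apply: eq_bigr => i _; rewrite mulrA.
Qed.

End Wronskian.

(** * Derivatives of ratios of Wronskians *)

Section WronskianCalculus.
Variable R : realType.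
Implicit Types (f : nat -> nat -> R -> R) (g : nat -> R -> R).

Lemma is_derive_mul (u v : R -> R) (x du dv : R) :
  is_derive x 1 u du -> is_derive x 1 v dv ->
  is_derive x 1 (fun y => u y * v y) (u x * dv + v x * du).
Proof. by move=> hu hv; exact: (@is_deriveM _ _ u v x 1 du dv hu hv). Qed.

Lemma is_derive_div (u v : R -> R) (x du dv : R) :
  is_derive x 1 u du -> is_derive x 1 v dv -> v x != 0 ->
  is_derive x 1 (fun y => u y / v y) ((du * v x - u x * dv) / v x ^+ 2).
Proof.
move=> hu hv v0.
have hV : is_derive x 1 (fun y => (v y)^-1) (- (v x) ^- 2 *: dv).
  apply: DeriveDef; first exact: (derivableV v0 (@ex_derive _ _ _ _ _ _ _ hv)).
  by rewrite (deriveV v0 (@ex_derive _ _ _ _ _ _ _ hv)) (@derive_val _ _ _ _ _ _ _ hv).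
have := is_derive_mul hu hV.
suff -> : u x * (- v x ^- 2 *: dv) + (v x)^-1 * du =
  (du * v x - u x * dv) / v x ^+ 2 by [].
by rewrite /GRing.scale/=; field.
Qed.

Lemma is_derive_sum_seq (T : Type) (r : seq T) (F : T -> R -> R) (dF : T -> R) (x : R) :
  (forall i, is_derive x 1 (F i) (dF i)) ->
  is_derive x 1 (fun y => \sum_(i <- r) F i y) (\sum_(i <- r) dF i).
Proof.
move=> hF; elim: r => [|i r IH].
  rewrite big_nil (_ : (fun y => _) = cst 0); first exact: is_derive_cst.
  by apply/funext => y; rewrite big_nil.
rewrite big_cons (_ : (fun y => _) = F i + (fun y => \sum_(j <- r) F j y)).
  exact: is_deriveD.
by apply/funext => y; rewrite big_cons.
Qed.

Lemma derivable_sum_seq (T : Type) (r : seq T) (F : T -> R -> R) (x : R) :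
  (forall i, derivable (F i) x 1) -> derivable (fun y => \sum_(i <- r) F i y) x 1.
Proof.
move=> hF; have {}hF i : is_derive x 1 (F i) ('D_1 (F i) x) by exact: derivableP.
exact: (@ex_derive _ _ _ _ _ _ _ (is_derive_sum_seq r hF)).
Qed.

Lemma derivable_mul (u v : R -> R) (x : R) :
  derivable u x 1 -> derivable v x 1 -> derivable (fun y => u y * v y) x 1.
Proof.
move=> /derivableP hu /derivableP hv.
exact: (@ex_derive _ _ _ _ _ _ _ (is_derive_mul hu hv)).
Qed.

Lemma derivable_prod_seq (T : Type) (r : seq T) (F : T -> R -> R) (x : R) :
  (forall i, derivable (F i) x 1) -> derivable (fun y => \prod_(i <- r) F i y) x 1.
Proof.
move=> dF; elim: r => [|i r IH].
  rewrite (_ : (fun y => _) = cst 1); first exact: derivable_cst.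
  by apply/funext => y; rewrite big_nil.
rewrite (_ : (fun y => _) = (fun y => F i y * \prod_(j <- r) F j y)).
  exact: derivable_mul (dF i) IH.
by apply/funext => y; rewrite big_cons.
Qed.

Lemma derivable_det k (M : R -> 'M[R]_k) (x : R) :
  (forall i j, derivable (fun y => M y i j) x 1) ->
  derivable (fun y => \det (M y)) x 1.
Proof.
move=> dM; apply: derivable_sum_seq => s.
by apply: derivable_mul; [exact: derivable_cst|exact: derivable_prod_seq].
Qed.

(* [g i] plays the role of the [i]-th derivative of [g 0]. *)
Definition jet_at g (x : R) := forall i, is_derive x 1 (g i) (g i.+1 x).

Definition wronf k f x : R := wron k (fun j i => f j i x).

Lemma wronf_upd k f j g x :
  wronf k (upd f j g) x = wron k (upd (fun l i => f l i x) j (g ^~ x)).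
Proof. by rewrite /wronf (upd_map (fun u i => u i x)). Qed.

Lemma jet_at_upd f j g x : (forall l, jet_at (f l) x) -> jet_at g x ->
  forall l, jet_at (upd f j g l) x.
Proof. by move=> jf jg l; rewrite /upd; case: eqP. Qed.

Lemma derivable_wronf k f x : (forall l, jet_at (f l) x) ->
  derivable (wronf k f) x 1.
Proof.
move=> jf; apply: derivable_det => i j.
by under eq_fun do rewrite mxE; have [] := jf j i.
Qed.

(** Variation of parameters: the ratios are the coefficients that express the first [k] derivatives
    of [g], from order 0 on, through those of the [f l]. Their derivatives solve a linear system
    with the same matrix, whose right side is zero except in the last row; Cramer's rule solves
    it. *)
Lemma is_derive_wron_ratio k f g (j : 'I_k) x :
  (forall l, jet_at (f l) x) -> jet_at g x -> wronf k f x != 0 ->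
  is_derive x 1 (fun y => wronf k (upd f j g) y / wronf k f y)
    (wron k (upd (fun l i => f l i x) j
       (fun i => if i.+1 == k then wronf k.+1 (upd f k g) x / wronf k f x
                 else 0)) / wronf k f x).
Proof.
move=> jf jg w0; set w := wronf k f; set v := (fun i => if _ then _ else _).
pose A (l : nat) y := wronf k (upd f l g) y.
have dA l : derivable (A l) x 1 by apply: derivable_wronf; exact: jet_at_upd.
have dw : derivable w x 1 by exact: derivable_wronf.
pose a' (l : nat) := ('D_1 (A l) x * w x - A l x * 'D_1 w x) / w x ^+ 2.
have da l : is_derive x 1 (fun y => A l y / w y) (a' l).
  exact: is_derive_div (derivableP (dA l)) (derivableP dw) w0.
have cr i y : (i < k)%N -> \sum_(l < k) A l y * f l i y = w y * g i y.
  move=> ik; rewrite -(wron_cramer (fun l i => f l i y) (g ^~ y) ik).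
  by apply: eq_bigr => l _; rewrite /A wronf_upd.
have cr' i : (i < k)%N -> \sum_(l < k) (A l x * f l i.+1 x + f l i x * 'D_1 (A l) x)
    = w x * g i.+1 x + g i x * 'D_1 w x.
  move=> ik.
  have dL : is_derive x 1 (fun y => \sum_(l < k) (A l y * f l i y))
      (\sum_(l < k) (A l x * f l i.+1 x + f l i x * 'D_1 (A l) x)).
    apply: is_derive_sum_seq => l; exact: is_derive_mul (derivableP (dA l)) (jf l i).
  have dR : is_derive x 1 (fun y => w y * g i y)
      (w x * g i.+1 x + g i x * 'D_1 w x).
    exact: is_derive_mul (derivableP dw) (jg i).
  have E : (fun y => \sum_(l < k) (A l y * f l i y)) = (fun y => w y * g i y).
    by apply/funext => y; exact: cr.
  by rewrite -(@derive_val _ _ _ _ _ _ _ dL) E (@derive_val _ _ _ _ _ _ _ dR).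
suff va i : (i < k)%N -> \sum_(l < k) a' l * f l i x = v i.
  rewrite (wron_upd_lin j va) mulfK//; exact: (da j).
(* Differentiating the [i]-th Cramer equation moves the terms with [f l i.+1] to the right. What is
   left there is the defect of equation [i.+1]: zero if [i.+1 < k], a quotient of Wronskians if
   [i.+1 = k]. *)
move=> ik; have -> : \sum_(l < k) a' l * f l i x =
    g i.+1 x - \sum_(l < k) A l x / w x * f l i.+1 x.
  have := cr' _ ik; rewrite big_split/= => /(canRL (addKr _)) E.
  under eq_bigr => l _.
    rewrite (_ : _ * _ = (f l i x * 'D_1 (A l) x) / w x -
       A l x * f l i x * ('D_1 w x / w x ^+ 2)); last by rewrite /a'; field.
    over.
  rewrite sumrB -!mulr_suml cr// E.
  under [in RHS]eq_bigr do rewrite mulrAC.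
  rewrite -mulr_suml.
  by field.
rewrite /v; case: eqP => [ik1|/eqP ik1].
  rewrite wronf_upd (@wron_upd_residual _ _ _ _ (fun l => A l x / w x)).
    by rewrite mulfK// -ik1.
  move=> i' ik'; under eq_bigr do rewrite mulrAC.
  by rewrite -mulr_suml cr// mulrAC divff// mul1r.
under eq_bigr do rewrite mulrAC.
by rewrite -mulr_suml cr 1?ltn_neqAle ?ik1// mulrAC divff// mul1r subrr.
Qed.

End WronskianCalculus.

(** * Counting zeros with Rolle's theorem *)

Section ZeroCounting.
Variable R : realType.
Implicit Types (D : set R) (u v w : R -> R) (s : seq R).

(** Counting through duplicate-free lists bounds the number of zeros without first knowing that the
    zero set is finite. *)
Definition zeros_le D u m := forall s, uniq s ->
  (forall x, x \in s -> D x /\ u x = 0) -> (size s <= m)%N.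

Lemma zeros_le_mul D u v m n : zeros_le D u m -> zeros_le D v n ->
  zeros_le D (fun x => u x * v x) (m + n).
Proof.
move=> um vn s us s0; rewrite -(count_predC (fun x => u x == 0)).
rewrite -!size_filter leq_add//; [apply: um|apply: vn]; rewrite ?filter_uniq//.
  by move=> x; rewrite mem_filter => /andP[/eqP ? /s0[]].
move=> x; rewrite mem_filter => /andP[/= ux /s0[Dx /eqP]].
by rewrite mulf_eq0 (negbTE ux) => /eqP.
Qed.

(** The half-open intervals between successive points are disjoint, so the witnesses chosen in them
    are distinct. *)
Lemma interlacing_seq (Q : R -> Prop) x s : path <%R x s ->
  (forall y z, y \in x :: s -> z \in x :: s -> y < z ->
    exists2 t, y <= t < z & Q t) ->
  exists t : seq R, [/\ size t = size s, uniq t & forall y, y \in t -> x <= y /\ Q y].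
Proof.
elim: s x => [|y s IH] x /=; first by exists [::].
move=> /andP[xy ys] gap.
have [|t [st ut tQ]] := IH _ ys.
  by move=> y' z' y's z's; apply: gap; rewrite inE ?y's ?z's orbT.
have [|||t0 /andP[xt0 t0y] Qt0] := gap x y; rewrite ?inE ?eqxx ?orbT//.
exists (t0 :: t); split => /=; first by rewrite st.
  by rewrite ut andbT; apply/negP => /tQ[]; rewrite leNgt t0y.
move=> z; rewrite inE => /predU1P[->//|/tQ[yz Qz]].
by split=> //; rewrite (le_trans (ltW xy)).
Qed.

(* Rolle's theorem for [u / w], which may have poles. *)
Lemma zeros_le_rolle D u w v d m n :
  (forall x y z, D x -> D z -> x <= y <= z -> D y) ->
  (forall x, D x -> w x != 0 -> is_derive x 1 (fun y => u y / w y) (d x)) ->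
  (forall x, D x -> w x != 0 -> d x = 0 -> v x = 0) ->
  zeros_le D v m -> zeros_le D w n -> zeros_le D u (m + n.*2).+1.
Proof.
move=> Dcvx dE dv vm wn s us s0.
(* At most [n] zeros of [u] are zeros of [w]. The others exceed the zeros of [v * w] by at most one,
   hence number at most [m + n + 1]. *)
rewrite -(count_predC (fun x => w x == 0)) -addnn addnA -addnS addnC addnS -addSn.
rewrite -!size_filter leq_add//; last first.
  apply: wn; first by rewrite filter_uniq.
  by move=> x; rewrite mem_filter => /andP[/eqP ? /s0[]].
set s' := [seq x <- s | _].
have us' : uniq s' by rewrite filter_uniq.
have s'0 x : x \in sort <=%R s' -> [/\ D x, u x = 0 & w x != 0].
  by rewrite mem_sort mem_filter => /andP[/= ? /s0[]].
have : sorted <%R (sort <=%R s').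
  by rewrite sort_lt_sorted.
rewrite -(size_sort <=%R s'); move: s'0; case: (sort _ _) => [|x t]//= s'0 xt.
have [|r [sr ur rQ]] := @interlacing_seq (fun x => D x /\ v x * w x = 0) _ _ xt.
  move=> y z /s'0[Dy uy wy] /s'0[Dz uz wz] yz.
  have Dyz t' : t' \in `[y, z] -> D t'.
    by rewrite in_itv/=; exact: Dcvx.
  (* Between two such zeros either [w] vanishes, or the ratio is differentiable throughout and Rolle
     yields a zero of [v]. *)
  have [[t' [t'yz wt']]|nw] := pselect (exists t', t' \in `[y, z] /\ w t' = 0).
    exists t'; last by split; [exact: Dyz|rewrite wt' mulr0].
    move: t'yz; rewrite in_itv/= => /andP[-> t'z]/=.
    by rewrite lt_neqAle t'z andbT; apply: contraNneq wz => <-; rewrite wt'.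
  have w0 t' : t' \in `[y, z] -> w t' != 0.
    by move=> t'yz; apply/eqP => wt'; apply: nw; exists t'.
  have du t' : t' \in `[y, z] -> is_derive t' 1 (fun y => u y / w y) (d t').
    by move=> t'yz; apply: dE; [exact: Dyz|exact: w0].
  have [|||c cyz dc] := @Rolle R (fun y => u y / w y) y z yz.
  - by move=> t' /subset_itv_oo_cc t'yz; exact: (@ex_derive _ _ _ _ _ _ _ (du _ t'yz)).
  - apply: derivable_within_continuous => t' t'yz.
    exact: (@ex_derive _ _ _ _ _ _ _ (du _ t'yz)).
  - by rewrite uy uz !mul0r.
  - have cyz' := subset_itv_oo_cc cyz.
    exists c; first by move: cyz; rewrite in_itv/= => /andP[/ltW-> ->].
    split; first exact: Dyz.
    rewrite (dv c) ?mul0r//; [exact: Dyz|exact: w0|].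
    by rewrite -(@derive_val _ _ _ _ _ _ _ (du _ cyz')) (@derive_val _ _ _ _ _ _ _ dc).
by rewrite -sr ltnS; apply: (zeros_le_mul vm wn) => // y /rQ[_ []].
Qed.

(** For the last column, the right side of the Cramer system has only its corner entry, so the
    derivative of the ratio is the product of the Wronskians of orders [k.+2] and [k] over the
    square of the one of order [k.+1]. *)
Lemma zeros_le_wronf D k (f : nat -> nat -> R -> R) (g : nat -> R -> R) a b c :
  (forall x y z, D x -> D z -> x <= y <= z -> D y) ->
  (forall x l, D x -> jet_at (f l) x) -> (forall x, D x -> jet_at g x) ->
  zeros_le D (wronf k.+2 (upd f k.+1 g)) a ->
  zeros_le D (wronf k f) b -> zeros_le D (wronf k.+1 f) c ->
  zeros_le D (wronf k.+1 (upd f k g)) (a + b + c.*2).+1.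
Proof.
move=> Dcvx jf jg za zb zc.
pose h x l i := f l i x.
pose d x := wronf k.+2 (upd f k.+1 g) x / wronf k.+1 f x * wronf k f x / wronf k.+1 f x.
apply: (@zeros_le_rolle D _ _ _ d _ _ Dcvx _ _ (zeros_le_mul za zb) zc) => x Dx wx.
  have := is_derive_wron_ratio (ord_max : 'I_k.+1) (fun l => jf x l Dx) (jg x Dx) wx.
  rewrite (wron_upd_last (h x)) => [|i ik]; last by rewrite eqSS ltn_eqF.
  by rewrite eqxx; exact.
move=> /eqP; rewrite /d !mulf_eq0 invr_eq0 (negbTE wx) !orbF.
by case/orP => /eqP ->; rewrite (mul0r, mulr0).
Qed.

End ZeroCounting.

(** * Zeros of a linear combination, given bounds for the Wronskians *)

Section Combination.
Variable R : realType.
Implicit Types (D : set R) (u v w : R -> R) (s : seq R).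

Lemma sub_zeros_le D u v m n : (forall x, D x -> u x = 0 -> v x = 0) ->
  (m <= n)%N -> zeros_le D v m -> zeros_le D u n.
Proof.
move=> uv mn vm s us s0; apply: leq_trans mn; apply: vm => // x /s0[Dx ux].
by split=> //; exact: uv.
Qed.

Lemma jet_at_comb n (c : nat -> R) (f : nat -> nat -> R -> R) x :
  (forall l, jet_at (f l) x) ->
  jet_at (fun i y => \sum_(l < n) c l * f l i y) x.
Proof.
move=> jf i; apply: is_derive_sum_seq => l.
have := is_derive_mul (is_derive_cst (c l) x 1) (jf l i).
by rewrite mulr0 addr0.
Qed.

Lemma zeros_le_comb D (f : nat -> nat -> R -> R) m (c : nat -> R) e :
  (forall x y z, D x -> D z -> x <= y <= z -> D y) ->
  (forall x l, D x -> jet_at (f l) x) -> c m != 0 ->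
  (forall k, (k <= m.+1)%N -> zeros_le D (wronf k f) e) ->
  zeros_le D (fun x => \sum_(j < m.+1) c j * f j 0 x) (m * (e + e.*2).+1 + e)%N.
Proof.
move=> Dcvx jf cm ze; pose g i y := \sum_(j < m.+1) c j * f j i y.
have jg x : D x -> jet_at g x by move=> Dx; apply: jet_at_comb => l; exact: jf.
(* Downward induction on the order [m - r]. Each step costs [e] for one Wronskian, twice [e] for the
   next, and one for Rolle; the final [e] is the bound for the full Wronskian at [r = 0]. *)
suff H r : (r <= m)%N ->
    zeros_le D (wronf (m - r).+1 (upd f (m - r) g)) (r * (e + e.*2).+1 + e)%N.
  apply: sub_zeros_le (leqnn _) (H m (leqnn m)) => x _.
  by rewrite subnn /wronf /wron (mx11_scalar (wronmx _ _)) det_scalar1 mxE.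
elim: r => [_|r IH rm].
  rewrite subn0; apply: sub_zeros_le (leqnn _) (ze m.+1 (leqnn _)) => x _.
  rewrite wronf_upd (@wron_upd_lin _ m.+1 (fun l i => f l i x) _ c ord_max)//.
  by move/eqP; rewrite mulf_eq0 (negbTE cm) => /eqP.
have E : (m - r = (m - r.+1).+1)%N by rewrite subnSK.
have := IH (ltnW rm); rewrite E => zr.
have k1 : ((m - r.+1).+1 <= m.+1)%N by rewrite ltnS leq_subr.
have := zeros_le_wronf Dcvx jf jg zr (ze _ (ltnW k1)) (ze _ k1).
apply: sub_zeros_le => //.
by rewrite mulSn; lia.
Qed.

End Combination.

(** * Jets of real powers of polynomials and the degree of their Wronskian *)

Section PowerJets.
Variable R : realType.
Implicit Types (p : {poly R} * R) (q : nat -> {poly R} * R) (x : R).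

(* The [i]-th derivative of [P `^ alpha] is [P `^ (alpha - i) * powder i]. *)
Fixpoint powder p i : {poly R} :=
  if i is i.+1 then
    (p.2 - i%:R) *: (p.1^`() * powder p i) + p.1 * (powder p i)^`()
  else 1.

Definition powjet p i x := p.1.[x] `^ (p.2 - i%:R) * (powder p i).[x].

Lemma powR_pred (y b : R) : 0 < y -> y `^ b = y * y `^ (b - 1).
Proof.
move=> y0; rewrite -{2}(powRr1 (ltW y0)) -powRD ?(gt_eqF y0) ?implybT//.
by congr (_ `^ _); ring.
Qed.

Lemma powjet_at p x : 0 < p.1.[x] -> jet_at (powjet p) x.
Proof.
move=> Px i; have hP := is_derive_poly p.1 x.
have hpow := is_derive1_comp (is_derive1_powR (p.2 - i%:R) Px) hP.
have := is_derive_mul hpow (is_derive_poly (powder p i) x).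
congr is_derive; rewrite /powjet /= hornerD hornerZ !hornerM.
have -> : p.2 - i.+1%:R = p.2 - i%:R - 1 by rewrite -addn1 natrD opprD addrA.
set b := p.2 - i%:R; rewrite (powR_pred b Px); ring.
Qed.

(** With [q j] the pair (P, alpha), column [j] of the Wronskian matrix has the common factor
    P^(alpha - (k - 1)); this determinant is what remains without these factors. Since [i <= k.-1],
    only natural exponents of P occur. *)
Definition polywron k q : {poly R} :=
  \det (\matrix_(i < k, j < k) ((q j).1 ^+ (k.-1 - i) * powder (q j) i)).

Lemma wronf_powjet k q x : (forall j, (j < k)%N -> 0 < (q j).1.[x]) ->
  wronf k (powjet \o q) x =
  (\prod_(j < k) (q j).1.[x] `^ ((q j).2 - k.-1%:R)) * (polywron k q).[x].
Proof.
move=> q0; rewrite -[RHS]mulrC -[(polywron k q).[x]]/(horner_eval x _).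
rewrite -det_map_mx.
pose d := \row_(j < k) (q j).1.[x] `^ ((q j).2 - k.-1%:R).
have -> : \prod_(j < k) (q j).1.[x] `^ ((q j).2 - k.-1%:R) = \det (diag_mx d).
  by rewrite det_diag; apply: eq_bigr => j _; rewrite mxE.
rewrite -det_mulmx; congr (\det _); apply/matrixP => i j.
rewrite mul_mx_diag !mxE /= /powjet /horner_eval !hornerE.
rewrite mulrAC; congr (_ * _); rewrite -powR_mulrn ?ltW ?q0//.
rewrite -powRD ?(gt_eqF (q0 _ _)) ?implybT//; congr (_ `^ _).
rewrite natrB; first by ring.
by have := ltn_ord i; lia.
Qed.

Lemma size_det_leq k (M : 'M[{poly R}]_k) e :
  (forall i j, (size (M i j) <= e.+1)%N) -> (size (\det M) <= (k * e).+1)%N.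
Proof.
move=> Me; apply: (leq_trans (size_sum _ _ _)); apply/bigmax_leqP => s _.
rewrite size_Msign (leq_trans (size_poly_prod_leq _ _))//.
rewrite leq_subLR card_ord; apply: (@leq_ltn_trans (\sum_(i < k) e.+1)).
  by apply: leq_sum => i _; exact: Me.
by rewrite sum_nat_const card_ord mulnS; lia.
Qed.

Lemma size_powder p d i : (size p.1 <= d.+1)%N ->
  (size (powder p i) <= (i * d).+1)%N.
Proof.
move=> pd; elim: i => [|i IH]; first by rewrite size_poly1.
have dpd : (size p.1^`() <= d)%N.
  by have [->|p0] := eqVneq p.1 0; [rewrite deriv0 size_poly0|have := lt_size_deriv p0; lia].
have dQ : (size (powder p i)^`() <= i * d)%N.
  have [->|Q0] := eqVneq (powder p i) 0; first by rewrite deriv0 size_poly0.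
  by have := lt_size_deriv Q0; lia.
rewrite [powder _ _]/= -/(powder p i); apply: (leq_trans (size_polyD _ _)).
rewrite geq_max; apply/andP; split.
  apply: (leq_trans (size_scale_leq _ _)); apply: (leq_trans (size_polyMleq _ _)).
  by rewrite mulSn; lia.
by apply: (leq_trans (size_polyMleq _ _)); rewrite mulSn; lia.
Qed.

Lemma size_polywron k q d : (forall j, (j < k)%N -> (size (q j).1 <= d.+1)%N) ->
  (size (polywron k q) <= (k * (k.-1 * d)).+1)%N.
Proof.
move=> qd; apply: size_det_leq => i j; rewrite mxE.
have jd := qd _ (ltn_ord j).
apply: (leq_trans (size_polyMleq _ _)).
have := size_powder i jd; have := size_poly_exp_leq (q j).1 (k.-1 - i).
have : ((size (q j).1).-1 * (k.-1 - i) <= d * (k.-1 - i))%N.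
  by rewrite leq_mul2r; apply/orP; right; lia.
(* The power and [powder] contribute complementary degrees, so the bound is the same in every
   row. *)
have -> : (k.-1 * d = d * (k.-1 - i) + i * d)%N.
  rewrite [(i * _)%N]mulnC -mulnDr subnK 1?mulnC//.
  by have := ltn_ord i; lia.
by lia.
Qed.

Lemma zeros_le_wronf_powjet (D : set R) k q d :
  (forall x j, D x -> (j < k)%N -> 0 < (q j).1.[x]) ->
  (forall j, (j < k)%N -> (size (q j).1 <= d.+1)%N) ->
  polywron k q != 0 -> zeros_le D (wronf k (powjet \o q)) (k * (k.-1 * d)).
Proof.
move=> q0 qd W0 s us s0; rewrite -ltnS.
apply: leq_trans (size_polywron qd); apply: max_poly_roots => //.
apply/allP => x /s0[Dx]; rewrite wronf_powjet; last by move=> j; exact: q0.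
move=> /eqP; rewrite mulf_eq0 => /orP[|//].
rewrite prodf_seq_eq0 => /hasP[j _] /=; rewrite powR_eq0.
by rewrite gt_eqF// q0.
Qed.

End PowerJets.

Arguments powjet {R} p i x.

(** * From locally constant to constant for rational functions up to powers *)

Section Gluing.
Variable R : realType.
Implicit Types (D : set R) (n w r s p : {poly R}).

Lemma poly_eq0_itv p a b : a < b -> (forall x, a < x < b -> p.[x] = 0) -> p = 0.
Proof.
move=> ab p0; apply/eqP; apply: contraT => pn0.
(* These are [size p] distinct roots, too many for a nonzero [p]; the shift to [i.+2] keeps them
   strictly below [b]. *)
pose rs := [seq a + (b - a) / i.+2%:R | i <- iota 0 (size p)].
have ba0 : 0 < b - a by rewrite subr_gt0.
have urs : uniq rs.
  rewrite map_inj_in_uniq ?iota_uniq// => i j _ _ /addrI /(mulfI (lt0r_neq0 ba0)).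
  by move=> /invr_inj/eqP; rewrite eqr_nat => /eqP[].
have : all (root p) rs.
  apply/allP => _ /mapP[i _ ->]; apply/eqP/p0; rewrite ltrDl divr_gt0//=.
  by rewrite -ltrBrDl ltr_pdivrMr// ltr_pMr// ltr1n.
by move=> /(max_poly_roots pn0)/(_ urs); rewrite size_map size_iota ltnn.
Qed.

(** The equation says that y = n/w solves s y' + r y = 0. At a root of [w] of order m + 1, the term
    s n w' would vanish to order exactly m and all others to a higher order. *)
Lemma coprime_root_neq0 n w r s x : coprimep n w -> w != 0 ->
  r * n * w + s * (n^`() * w - n * w^`()) = 0 -> s.[x] != 0 -> w.[x] != 0.
Proof.
move=> nw w0 E sx; apply/negP => wx.
have [[|m] [v vx Ew]] := multiplicity_XsubC w x.
  by move: vx; rewrite w0 /root -[v]mulr1 -(expr0 ('X - x%:P)) -Ew wx.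
rewrite w0/= in vx; set t := 'X - x%:P in Ew.
have nx : n.[x] != 0.
  apply/negP => nx; have := coprimep_root nw nx.
  by rewrite (eqP wx) eqxx.
have : t ^+ m * (r * n * v * t + s * (n^`() * v * t -
    n * (v^`() * t + v *+ m.+1))) = 0.
  rewrite -[RHS]E Ew derivM deriv_exp derivXsubC -/t mul1r /= exprS.
  by rewrite -(mulr_natr v) -(mulr_natr (t ^+ m)); ring.
move=> /eqP; rewrite mulf_eq0 expf_eq0 polyXsubC_eq0 andbF/= => /eqP.
move=> /(congr1 (horner^~ x)); rewrite /t.
rewrite !(horner0, hornerD, hornerN, hornerM, hornerMn, hornerX, hornerC).
rewrite subrr !(mulr0, add0r) => /eqP.
rewrite !mulf_eq0 (negbTE sx) oppr_eq0 mulf_eq0 (negbTE nx) mulrn_eq0/=.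
by rewrite -[_ == 0]/(root v x) (negbTE vx).
Qed.

(** A priori the constant could change across a root of [w]. The vanishing derivative is however a
    polynomial identity, and it forbids poles in [D] once the fraction is in lowest terms; the mean
    value theorem then applies on all of [D]. *)
Lemma locally_constant_rational D (u : R -> R) n w r s :
  (forall x y z, D x -> D z -> x <= y <= z -> D y) ->
  (exists x y, [/\ D x, D y & x < y]) ->
  (forall x, D x -> s.[x] != 0) -> (forall x, D x -> u x != 0) ->
  (forall x, D x -> is_derive x 1 u (u x * (r.[x] / s.[x]))) -> w != 0 ->
  (forall x, D x -> w.[x] != 0 -> is_derive x 1 (fun y => u y * (n.[y] / w.[y])) 0) ->
  exists A, forall x, D x -> w.[x] != 0 -> u x * (n.[x] / w.[x]) = A.
Proof.
move=> Dcvx [x0 [x1 [Dx0 Dx1 x01]]] s0 u0 du w0 d0.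
have dratio (n1 w1 : {poly R}) x : D x -> w1.[x] != 0 ->
    is_derive x 1 (fun y => u y * (n1.[y] / w1.[y]))
     (u x / (s.[x] * w1.[x] ^+ 2) *
      (r * n1 * w1 + s * (n1^`() * w1 - n1 * w1^`())).[x]).
  move=> Dx wx.
  have := is_derive_mul (du x Dx) (is_derive_div (is_derive_poly n1 x) (is_derive_poly w1 x) wx).
  congr is_derive; rewrite !(hornerD, hornerM, hornerN).
  by field; rewrite wx s0.
pose Psi n1 w1 : {poly R} := r * n1 * w1 + s * (n1^`() * w1 - n1 * w1^`()).
have Psi0 : Psi n w = 0.
  (* The extra factor [w] makes the product vanish at the roots of [w] too, hence on a whole
     interval. *)
  suff /eqP : Psi n w * w = 0 by rewrite mulf_eq0 (negbTE w0) orbF => /eqP.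
  apply: (poly_eq0_itv x01) => x /andP[x0x xx1].
  have Dx : D x by apply: (Dcvx x0 x x1) => //; rewrite !ltW.
  rewrite hornerM; have [->|wx] := eqVneq w.[x] 0; first by rewrite mulr0.
  have := @derive_val _ _ _ _ _ _ _ (dratio n w x Dx wx).
  rewrite (@derive_val _ _ _ _ _ _ _ (d0 x Dx wx)) => /esym/eqP.
  rewrite !mulf_eq0 invr_eq0 mulf_eq0 expf_eq0/=.
  rewrite (negbTE (u0 _ Dx)) (negbTE (s0 _ Dx)) (negbTE wx)/=.
  by move=> /eqP->; rewrite mul0r.
pose g := gcdp n w.
have g0 : g != 0 by rewrite gcdp_eq0 (negbTE w0) andbF.
pose n1 := n %/ g; pose w1 := w %/ g.
have En : n = n1 * g by rewrite divpK// dvdp_gcdl.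
have Ew : w = w1 * g by rewrite divpK// dvdp_gcdr.
have w10 : w1 != 0 by apply: contraNneq w0; rewrite Ew => ->; rewrite mul0r.
have nw1 : coprimep n1 w1 by apply: coprimep_div_gcd; rewrite w0 orbT.
have Psi10 : Psi n1 w1 = 0.
  have : Psi n w = Psi n1 w1 * g ^+ 2.
    by rewrite /Psi En Ew !derivM; ring.
  by rewrite Psi0 => /esym/eqP; rewrite mulf_eq0 expf_eq0 (negbTE g0) orbF => /eqP.
have w1x x : D x -> w1.[x] != 0.
  by move=> /s0; exact: coprime_root_neq0 Psi10.
pose h x := u x * (n1.[x] / w1.[x]).
have dh x : D x -> is_derive x 1 h 0.
  by move=> Dx; have := dratio n1 w1 x Dx (w1x x Dx); rewrite -/(Psi n1 w1) Psi10 horner0 mulr0.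
have hc x y : D x -> D y -> x < y -> h x = h y.
  move=> Dx Dy xy; have Dxy z : z \in `[x, y] -> D z by rewrite in_itv/=; exact: Dcvx.
  have [||c _ ] := @MVT R h (fun=> 0) x y xy.
  - by move=> z /subset_itv_oo_cc/Dxy; exact: dh.
  - apply: derivable_within_continuous => z /Dxy Dz.
    exact: (@ex_derive _ _ _ _ _ _ _ (dh _ Dz)).
  - by rewrite mul0r => /eqP; rewrite subr_eq0 => /eqP.
exists (h x0) => x Dx wx.
have gx : g.[x] != 0 by apply: contraNneq wx => gx; rewrite Ew hornerM gx mulr0.
have -> : u x * (n.[x] / w.[x]) = h x.
  by rewrite En Ew !hornerM /h; field; rewrite gx w1x.
by have [/hc|/hc|->] := ltgtP x x0; [apply| move=> /(_ Dx0 Dx)|].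
Qed.

(** If [phi x] were nonzero, [phi] would be nonzero on a ball, and [w] would vanish there. *)
Lemma continuous_eq0_off_roots D (phi : R -> R) w (x : R) : open D -> D x ->
  {for x, continuous phi} -> w != 0 ->
  (forall y, D y -> w.[y] != 0 -> phi y = 0) -> phi x = 0.
Proof.
move=> Dopen Dx cphi w0 phi0; apply/eqP; apply: contraT => phix.
have : \forall y \near x, D y /\ phi y != 0.
  apply: filterI; first exact: open_nbhs_nbhs.
  exact: cvgr_neq0 cphi phix.
move=> /nbhs_ballP[e /= e0 be].
rewrite (@poly_eq0_itv w (x - e) (x + e)) ?eqxx// in w0.
  by rewrite ltrD2l gtrN.
move=> y xye; have [|Dy phiy] := be y.
  by rewrite /ball/= distrC ltr_distl.
by apply/eqP; apply: contraTT phiy => /(phi0 _ Dy)->; rewrite eqxx.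
Qed.

End Gluing.

(** * Linear independence forces nonzero Wronskians *)

Section Independence.
Variable R : realType.
Implicit Types (D : set R) (p : {poly R} * R) (q : nat -> {poly R} * R).

Lemma is_derive_powR_horner (p : {poly R}) (b x : R) : 0 < p.[x] ->
  is_derive x 1 (fun y => p.[y] `^ b) (p.[x] `^ b * (b * p^`().[x] / p.[x])).
Proof.
move=> px; have := is_derive1_comp (is_derive1_powR b px) (is_derive_poly p x).
by congr is_derive; rewrite (powR_pred b px); field; rewrite gt_eqF.
Qed.

Lemma polywron0 q : polywron 0 q = 1.
Proof. by rewrite /polywron det_mx00. Qed.

Lemma polywron1 q : polywron 1 q = 1.
Proof. by rewrite /polywron (mx11_scalar (\matrix_(i, j) _)) det_scalar1 mxE mul1r. Qed.

(** The power factors of all columns other than [j] cancel, which puts a Cramer coefficient in the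
    form of a quotient of powers times a rational function. *)
Lemma polywron_upd_ratio k q p (j : 'I_k) x :
  (forall l, 0 < (q l).1.[x]) -> 0 < p.1.[x] -> (polywron k q).[x] != 0 ->
  wronf k (upd (powjet \o q) j (powjet p)) x / wronf k (powjet \o q) x =
  p.1.[x] `^ (p.2 - k.-1%:R) / (q j).1.[x] `^ ((q j).2 - k.-1%:R) *
  ((polywron k (upd q j p)).[x] / (polywron k q).[x]).
Proof.
move=> q0 p0 W0.
have -> : upd (powjet \o q) j (powjet p) = powjet \o upd q j p by rewrite -upd_map.
rewrite !wronf_powjet//; last by move=> l _; rewrite /upd; case: eqP.
rewrite (bigD1 j)//= [in X in _ / X](bigD1 j)//= {1 2}/upd eqxx.
set r := \prod_(i < k | _) _; set r' := \prod_(i < k | _) _.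
have -> : r = r'.
  apply: eq_bigr => i ij; rewrite /upd (_ : (i == j :> nat) = false)//.
  exact: negbTE.
have r0 : r' != 0.
  by apply: lt0r_neq0; apply: prodr_gt0 => i _; rewrite powR_gt0.
have pj : (q j).1.[x] `^ ((q j).2 - k.-1%:R) != 0 by rewrite gt_eqF// powR_gt0.
by field; rewrite W0 r0 pj.
Qed.

(* By Cramer's rule the coefficients expressing [f k.+1] in terms of
   [f 0, ..., f k] are ratios of Wronskians; they have derivative zero where
   they are defined, and are rational functions up to powers. *)
Lemma polywron_eq0_dep D k q : open D ->
  (forall x y z, D x -> D z -> x <= y <= z -> D y) ->
  (exists x y, [/\ D x, D y & x < y]) ->
  (forall x j, D x -> 0 < (q j).1.[x]) ->
  polywron k.+1 q != 0 -> polywron k.+2 q = 0 ->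
  exists A : 'I_k.+1 -> R, forall x, D x ->
    \sum_(j < k.+1) A j * (q j).1.[x] `^ (q j).2 = (q k.+1).1.[x] `^ (q k.+1).2.
Proof.
move=> Dopen Dcvx Dxy q0 W0 W1; pose f := powjet \o q.
have jf x l : D x -> jet_at (f l) x by move=> Dx; apply: powjet_at; exact: q0.
have wf x : D x -> (polywron k.+1 q).[x] != 0 -> wronf k.+1 f x != 0.
  move=> Dx Wx; rewrite wronf_powjet ?mulf_neq0//; last by move=> j _; exact: q0.
  by apply: lt0r_neq0; apply: prodr_gt0 => i _; rewrite powR_gt0// q0.
have ex (j : 'I_k.+1) : exists A, forall x, D x -> (polywron k.+1 q).[x] != 0 ->
    wronf k.+1 (upd f j (f k.+1)) x / wronf k.+1 f x = A.
  (* The last two polynomials are numerator and denominator of the logarithmic derivative of the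
     quotient of powers. *)
  have [|||||A AE] := @locally_constant_rational R D
      (fun y => (q k.+1).1.[y] `^ ((q k.+1).2 - k%:R) / (q j).1.[y] `^ ((q j).2 - k%:R))
      (polywron k.+1 (upd q j (q k.+1))) (polywron k.+1 q)
      (((q k.+1).2 - k%:R) *: ((q k.+1).1^`() * (q j).1) -
       ((q j).2 - k%:R) *: ((q j).1^`() * (q k.+1).1))
      ((q k.+1).1 * (q j).1) Dcvx Dxy.
  - by move=> x Dx; rewrite hornerM mulf_neq0// gt_eqF// q0.
  - by move=> x Dx; rewrite mulf_neq0 ?invr_eq0// gt_eqF// powR_gt0// q0.
  - move=> x Dx; have Pk := q0 x k.+1 Dx; have Pj := q0 x j Dx.
    have pj : (q j).1.[x] `^ ((q j).2 - k%:R) != 0 by rewrite gt_eqF// powR_gt0.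
    have := is_derive_div (is_derive_powR_horner ((q k.+1).2 - k%:R) Pk)
      (is_derive_powR_horner ((q j).2 - k%:R) Pj) pj.
    congr is_derive; rewrite hornerD hornerN !hornerZ !hornerM.
    by field; rewrite pj !gt_eqF.
  - exact: W0.
  - move=> x Dx Wx.
    have := is_derive_wron_ratio j (fun l => jf x l Dx) (jf x k.+1 Dx) (wf _ Dx Wx).
    (* Since [polywron k.+2 q] is zero, so is the right side of the system for the derivatives of
       the coefficients. *)
    have -> : wronf k.+2 (upd f k.+1 (f k.+1)) x = 0.
      rewrite (_ : upd _ _ _ = f); last first.
        by apply/funext => l; rewrite /upd; case: eqP => // ->.
      by rewrite wronf_powjet ?W1 ?horner0 ?mulr0// => l _; exact: q0.
    rewrite (@wron_upd_lin _ _ _ _ (fun=> 0)); last first.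
      by move=> i _; rewrite mul0r if_same big1// => l _; rewrite mul0r.
    rewrite !mul0r; apply: near_eq_is_derive.
    (* The closed form needs a nonzero Wronskian polynomial, which continuity gives near [x]. *)
    near=> y.
    have Dy : D y by near: y; exact: open_nbhs_nbhs.
    rewrite polywron_upd_ratio//; [by move=> l; exact: q0|exact: q0|].
    near: y.
    exact: cvgr_neq0 (@continuous_horner _ (polywron k.+1 q) x) Wx.
  exists A => x Dx Wx; rewrite polywron_upd_ratio//; first exact: AE.
    by move=> l; exact: q0.
  exact: q0.
have [A AE] := choice ex.
exists A => x Dx; apply/eqP; rewrite -subr_eq0; apply/eqP.
(* Off the roots of [polywron k.+1 q] the relation is the Cramer equation of order 0; continuity
   extends it to the roots. *)
apply: (@continuous_eq0_off_roots R D (fun x => \sum_(j < k.+1)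
  A j * (q j).1.[x] `^ (q j).2 - (q k.+1).1.[x] `^ (q k.+1).2) _ _ Dopen Dx _ W0).
  apply/differentiable_continuous/derivable1_diffP.
  apply: derivableB; last exact: (@ex_derive _ _ _ _ _ _ _ (is_derive_powR_horner _ (q0 _ _ Dx))).
  apply: derivable_sum_seq => j; apply: derivable_mul; first exact: derivable_cst.
  exact: (@ex_derive _ _ _ _ _ _ _ (is_derive_powR_horner _ (q0 _ _ Dx))).
move=> y Dy Wy; apply/eqP; rewrite subr_eq0; apply/eqP.
have f0 l : f l 0%N y = (q l).1.[y] `^ (q l).2.
  by rewrite /f /powjet/= subr0 hornerC mulr1.
have := wron_cramer (fun l i => f l i y) ((f k.+1)^~ y) (ltn0Sn k).
rewrite f0 => E; apply: (mulfI (wf y Dy Wy)); rewrite -[RHS]E mulr_sumr.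
apply: eq_bigr => j _; rewrite -(AE j y Dy Wy) wronf_upd f0 mulrA mulrCA.
by rewrite divff ?mulr1// wf.
Unshelve. all: by end_near. Qed.

End Independence.

(** * Cardinality, open intervals and the final bound *)

Lemma zeros_le_card (R : realType) (D : set R) (u : R -> R) m :
  zeros_le D u m -> ([set x | D x /\ u x = 0] #<= `I_m)%card.
Proof.
(* An infinite zero set would contain more than [m] distinct zeros. *)
move=> um; have [/finite_seqP[s sE]|/(infinite_set_fset m.+1)[B BD]] :=
    pselect (finite_set [set x | D x /\ u x = 0]); last first.
  by move=> mB; have := um _ (fset_uniq B) BD; rewrite leqNgt mB.
rewrite sE; have -> : [set` s] = [set` [fset x in s]%fset].
  by apply/seteqP; split=> x /=; rewrite inE.
have /card_eq_fsetP Bn := erefl #|` [fset x in s]%fset|.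
rewrite (card_le_eql Bn) card_le_II; apply: um; first exact: fset_uniq.
move=> x; rewrite inE /= => xs.
by have : [set` s] x by []; rewrite -sE.
Qed.

Lemma open_itv_open (R : realType) (a b : \bar R) : open (open_itv a b).
Proof.
by apply: openI; [exact: open_ereal_gt|exact: open_ereal_lt].
Qed.

Lemma open_itv_infinite (R : realType) (a b : \bar R) : (a < b)%E ->
  exists x y, [/\ open_itv a b x, open_itv a b y & x < y].
Proof.
case: a b => [a| |] [b| |]//=; rewrite /open_itv/= ?lte_fin.
- move=> ab; exists (a + (b - a) / 3), (a + (b - a) / 2).
  by split; rewrite ?lte_fin; try split; lra.
- by move=> _; exists (a + 1), (a + 2); rewrite !lte_fin !ltry; split; try split => //; lra.
- by move=> _; exists (b - 2), (b - 1); rewrite !lte_fin !ltNyr; split; try split => //; lra.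
- by move=> _; exists 0, 1; rewrite !ltNyr !ltry.
Qed.

Lemma polywron_neq0 (R : realType) n (D : set R) (q : nat -> {poly R} * R) :
  open D -> (forall x y z, D x -> D z -> x <= y <= z -> D y) ->
  (exists x y, [/\ D x, D y & x < y]) ->
  (forall x j, D x -> 0 < (q j).1.[x]) ->
  lin_indep_on D (fun (k : 'I_n) x => (q k).1.[x] `^ (q k).2) ->
  forall k, (k <= n)%N -> polywron k q != 0.
Proof.
move=> Dopen Dcvx Dxy q0 qfree; case=> [_|]; first by rewrite polywron0 oner_neq0.
elim=> [_|k IH kn]; first by rewrite polywron1 oner_neq0.
apply/eqP => W1.
have [A AE] := polywron_eq0_dep Dopen Dcvx Dxy q0 (IH (ltnW kn)) W1.
(* The dependency, padded with zeros beyond [k.+1]; its entry -1 at [k.+1] contradicts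
   independence. *)
pose l (j : nat) : R := if insub j is Some i then A i else if j == k.+1 then -1 else 0.
have lk : l k.+1 = -1 by rewrite /l insubF ?ltnn// eqxx.
have l0 j : (k.+1 < j)%N -> l j = 0.
  by move=> kj; rewrite /l insubF ?gtn_eqF// ltnNge ltnW.
have lA (j : 'I_k.+1) : l j = A j by rewrite /l valK.
have /(_ (Ordinal kn))/= : forall j : 'I_n, l j = 0.
  apply: qfree => x Dx.
  pose G j := l j * (q j).1.[x] `^ (q j).2.
  rewrite -(big_mkord xpredT G) (big_cat_nat (leq0n k.+2) kn)/= [X in _ + X]big_nat.
  rewrite [X in _ + X]big1 ?addr0; last by move=> j /andP[kj _]; rewrite /G l0 ?mul0r.
  rewrite big_mkord big_ord_recr/= /G lk mulN1r -AE//.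
  by under eq_bigr do rewrite lA; rewrite subrr.
by rewrite lk => /eqP; rewrite oppr_eq0 oner_eq0.
Qed.

Theorem theorem1p3 (R : realType) (n d : nat) (P : 'I_n -> {poly R})
    (a b : \bar R) (alpha c : 'I_n -> R)
    (Pdeg : forall k, (size (P k) <= d.+1)%N)
    (ab : (a < b)%E)
    (Ppos : forall k x, open_itv a b x -> 0 < (P k).[x])
    (Pfree : lin_indep_on (open_itv a b) (fun k x => (P k).[x] `^ alpha k))
    (c_neq0 : exists k, c k != 0) :
  ([set x : R | open_itv a b x /\
      \sum_(k < n) c k * (P k).[x] `^ alpha k = 0]
    #<= `I_(4 * n ^ 3 * d + n)%N)%card.
Proof.
apply: zeros_le_card; set D := open_itv a b in Ppos Pfree *.
have Dcvx x y z : D x -> D z -> x <= y <= z -> D y.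
  move=> [ax _] [_ zb] /andP[xy yz]; split.
    by apply: lt_le_trans ax _; rewrite lee_fin.
  by apply: le_lt_trans zb; rewrite lee_fin.
(* The default pair, the constant 1 with exponent 0, satisfies the positivity and degree bounds at
   every index. *)
pose q j : {poly R} * R := if insub j is Some i then (P i, alpha i) else (1, 0).
have qE (k : 'I_n) : q k = (P k, alpha k) by rewrite /q valK.
have q0 x j : D x -> 0 < (q j).1.[x].
  by rewrite /q; case: insubP => [i _ _|_] Dx /=; [exact: Ppos|rewrite hornerC].
have qd j : (size (q j).1 <= d.+1)%N.
  by rewrite /q; case: insubP => [i _ _|_] //=; rewrite size_poly1.
have Dopen : open D by exact: open_itv_open.
have W0 k : (k <= n)%N -> polywron k q != 0.
  apply: (polywron_neq0 Dopen Dcvx (open_itv_infinite ab)) => // l lE.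
  by apply: Pfree => x Dx; rewrite -[RHS](lE x Dx); apply: eq_bigr => k' _; rewrite qE.
pose e := (n * (n * d))%N.
have We k : (k <= n)%N -> zeros_le D (wronf k (powjet \o q)) e.
  move=> kn; apply: (sub_zeros_le (fun _ _ => id)) (@zeros_le_wronf_powjet R D k q d _ _ (W0 k kn)).
  - by rewrite /e leq_mul// leq_mul//; exact: leq_trans (leq_pred _) kn.
  - by move=> x j Dx _; exact: q0.
  - by move=> j _; exact: qd.
pose C (j : nat) : R := if insub j is Some i then c i else 0.
have CE (k : 'I_n) : C k = c k by rewrite /C valK.
have [i0 ci0] := c_neq0.
(* Taking the last nonzero coefficient makes the top Wronskian a nonzero multiple of that of the
   powers. *)
case: (@arg_maxnP _ i0 (fun i => c i != 0) val ci0) => m cm mmax.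
have jf x l : D x -> jet_at (powjet (q l)) x by move=> Dx; apply: powjet_at; exact: q0.
have Cm : C m != 0 by rewrite CE.
have H := zeros_le_comb Dcvx jf Cm (fun k km => We k (leq_trans km (ltn_ord m))).
apply: sub_zeros_le H.
  move=> x Dx ux; rewrite -[RHS]ux.
  pose G j := C j * (q j).1.[x] `^ (q j).2.
  rewrite (_ : \sum_(k < n) _ = \sum_(k < n) G k); last first.
    by apply: eq_bigr => k _; rewrite /G CE qE.
  rewrite -(big_mkord xpredT G) (big_cat_nat (leq0n m.+1) (ltn_ord m))/=.
  rewrite [X in _ + X]big_nat [X in _ + X]big1 ?addr0.
    rewrite big_mkord; apply: eq_bigr => j _.
    by rewrite /G /powjet/= subr0 hornerC mulr1.
  move=> j /andP[mj jn]; rewrite /G (CE (Ordinal jn)).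
  suff /eqP-> : c (Ordinal jn) == 0 by rewrite mul0r.
  by apply: contraLR mj => /mmax /=; rewrite -leqNgt.
(* The count is m(3e + 1) + e with m < n, hence at most 4ne + n, where ne = n^3 d. *)
have mn : (m.+1 * e <= n * e)%N by rewrite leq_mul.
have -> : (4 * n ^ 3 * d = 4 * (n * e))%N by rewrite /e !expnS expn0; ring.
have := ltn_ord m; move: mn; rewrite -addnn mulSn mulnS !mulnDr; lia.
Qed.
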